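(* Let $E$ be a truncated Riesz space, and let $E\oplus\mathbb{R}$ be its Alexandroff unitization. If $E$ is unital and uniformly complete, then $E\oplus\mathbb{R}$ is uniformly complete.
   Context: A truncation on a (real) Riesz space $E$ is a map $x\mapsto\bar{x}$ from $E^{+}$ to $E^{+}$ such that for all $a,b\in E^{+}$: $(\tau_1)$ $a\wedge\bar{b}\leq\bar{a}\leq a$; $(\tau_2)$ $\bar{a}=0$ implies $a=0$. A truncated Riesz space is a Riesz space $E$ equipped with a truncation. It is called unital if there exists $u\in E^{+}$ (the truncation unit) such that $\bar{x}=x\wedge u$ for all $x\in E^{+}$. The set of fixed points is $\bar{E}=\{x\in E:\overline{|x|}=|x|\}$. The (Alexandroff) unitization $E\oplus\mathbb{R}=\{x+\lambda: x\in E,\lambda\in\mathbb{R}\}$ is the vector space $E\times\mathbb{R}$ (with $E$ identified with $E\times\{0\}$ and $\mathbb{R}$ with $\{0\}\times\mathbb{R}$, so $1=(0,1)$), ordered by the positive cone $(E\oplus\mathbb{R})^{+}=E^{+}\cup\{x+\lambda: x\in E,\ \lambda\in\mathbb{R},\ \lambda>0,\ \tfrac{1}{\lambda}x^{-}\in\bar{E}\}$. It is known that $E\oplus\mathbb{R}$ is a Riesz space, that $E$ is a vector sublattice (indeed a maximal ideal) of it, and that $\bar{x}=x\wedge 1$ for all $x\in E^{+}$. This space is used whether or not $E$ is unital. Let $F$ be a Riesz space and $v\in F^{+}$. A sequence $(x_n)$ in $F$ converges $v$-uniformly to $x\in F$ ($x$ is a $v$-uniform limit) if for every real $\epsilon>0$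 there is $N_\epsilon$ with $|x_n-x|\leq\epsilon v$ for all $n\geq N_\epsilon$. It is $v$-uniformly Cauchy if for every real $\epsilon>0$ one has $|x_n-x_m|\leq\epsilon v$ for all sufficiently large $n,m$. $F$ is (relatively) uniformly complete if for every $v\in F^{+}$ every $v$-uniform Cauchy sequence in $F$ has a $v$-uniform limit in $F$. *)

(* Defs.v *)
From HB Require Import structures.
From mathcomp Require Import all_boot all_order all_algebra.
From mathcomp Require Import reals.

Set Implicit Arguments.
Unset Strict Implicit.
Unset Printing Implicit Defensive.

Import Order.TTheory GRing.Theory Num.Theory.
Local Open Scope ring_scope.

(* Riesz spaces (vector lattices) over the reals [R]. The                     *)
(* library's [Order.Lattice] cannot be used as a parent: Hierarchy Builder    *)
(* rejects a structure joining it with [GRing.Zmodule] declared after         *)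
(* [Num.RealDomain]. The lattice operations are specified as in the factory   *)
(* [Order.POrder_MeetJoin_isLattice].                                         *)

HB.mixin Record POrderedLmodule_isRiesz (R : realType) V
    of Num.POrderedZmodule V & GRing.Lmodule R V := {
  riesz_leD2r : forall x y z : V, x <= y -> x + z <= y + z;
  riesz_scale_ge0 : forall (a : R) (x : V), 0 <= a -> 0 <= x -> 0 <= a *: x;
  rmeet : V -> V -> V;
  rjoin : V -> V -> V;
  rmeetP : forall x y z : V, (x <= rmeet y z) = (x <= y) && (x <= z);
  rjoinP : forall x y z : V, (rjoin x y <= z) = (x <= z) && (y <= z) }.

#[short(type="rieszType")]
HB.structure Definition Riesz (R : realType) :=
  { V of Num.POrderedZmodule V & GRing.Lmodule R V
         & POrderedLmodule_isRiesz R V }.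

Definition rabs (R : realType) (V : rieszType R) (x : V) : V := rjoin x (- x).
Definition rpos (R : realType) (V : rieszType R) (x : V) : V := rjoin x 0.
Definition rneg (R : realType) (V : rieszType R) (x : V) : V := rjoin (- x) 0.

Definition uniform_limit (R : realType) (V : rieszType R) (v : V)
    (x : nat -> V) (l : V) : Prop :=
  forall eps : R, 0 < eps ->
    exists N : nat, forall n, (N <= n)%N -> rabs (x n - l) <= eps *: v.

Definition uniform_cauchy (R : realType) (V : rieszType R) (v : V)
    (x : nat -> V) : Prop :=
  forall eps : R, 0 < eps ->
    exists N : nat, forall n m, (N <= n)%N -> (N <= m)%N ->
      rabs (x n - x m) <= eps *: v.

Definition uniformly_complete (R : realType) (V : rieszType R) : Prop :=
  forall v : V, 0 <= v -> forall x : nat -> V, uniform_cauchy v x ->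
    exists l : V, uniform_limit v x l.

(* A truncation is a map on the positive cone; [trunc] is total, but nothing  *)
(* is assumed about it outside the positive cone.                             *)

HB.mixin Record Riesz_isTruncated (R : realType) V of Riesz R V := {
  trunc : V -> V;
  trunc_ge0 : forall a : V, 0 <= a -> 0 <= trunc a;
  trunc_meet : forall a b : V, 0 <= a -> 0 <= b -> rmeet a (trunc b) <= trunc a;
  trunc_le : forall a : V, 0 <= a -> trunc a <= a;
  trunc_eq0 : forall a : V, 0 <= a -> trunc a = 0 -> a = 0 }.

#[short(type="truncRieszType")]
HB.structure Definition TruncRiesz (R : realType) :=
  { V of Riesz_isTruncated R V & Riesz R V }.

Definition unital (R : realType) (E : truncRieszType R) : Prop :=
  exists u : E, 0 <= u /\ forall x : E, 0 <= x -> trunc x = rmeet x u.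

Definition trunc_fixed (R : realType) (E : truncRieszType R) : {pred E} :=
  [pred x | trunc (rabs x) == rabs x].
Arguments trunc_fixed {R} E.

Section RieszTheory.
Context (R : realType) (V : rieszType R).
Implicit Types (x y z t : V) (a b : R).

Lemma rsubr_ge0 x y : (0 <= y - x) = (x <= y).
Proof.
apply/idP/idP => [/(@riesz_leD2r _ _ _ _ x)|/(@riesz_leD2r _ _ _ _ (- x))].
  by rewrite add0r subrK.
by rewrite subrr.
Qed.

Lemma rleD2r x y z : (x + z <= y + z) = (x <= y).
Proof.
by rewrite -(rsubr_ge0 (x + z)) opprD addrACA subrr addr0 rsubr_ge0.
Qed.

Lemma rleD x y z t : x <= y -> z <= t -> x + z <= y + t.
Proof.
move=> xy zt; apply: (@le_trans _ _ (y + z)); first by rewrite rleD2r.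
by rewrite ![y + _]addrC rleD2r.
Qed.

Lemma raddr_ge0 x y : 0 <= x -> 0 <= y -> 0 <= x + y.
Proof. by move=> x0 y0; rewrite -[0]addr0 rleD. Qed.

Lemma rleBlDr x y z : (x - y <= z) = (x <= z + y).
Proof. by rewrite -(rleD2r (x - y) z y) subrK. Qed.

Lemma rscale_le a x y : 0 <= a -> x <= y -> a *: x <= a *: y.
Proof.
by move=> a0 xy; rewrite -rsubr_ge0 -scalerBr riesz_scale_ge0 ?rsubr_ge0.
Qed.

Lemma rscale_le2 a b x : a <= b -> 0 <= x -> a *: x <= b *: x.
Proof.
by move=> ab x0; rewrite -rsubr_ge0 -scalerBl riesz_scale_ge0 ?subr_ge0.
Qed.

Lemma rjoin_l x y : x <= rjoin x y.
Proof. by have := lexx (rjoin x y); rewrite rjoinP => /andP[]. Qed.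

Lemma rjoin_r x y : y <= rjoin x y.
Proof. by have := lexx (rjoin x y); rewrite rjoinP => /andP[]. Qed.

Lemma rneg_ge0 x : 0 <= rneg x. Proof. exact: rjoin_r. Qed.
Lemma rpos_ge0 x : 0 <= rpos x. Proof. exact: rjoin_r. Qed.

Lemma rpos_ge x : x <= rpos x. Proof. exact: rjoin_l. Qed.

Lemma rposBneg x : rpos x - rneg x = x.
Proof.
suff -> : rpos x = x + rneg x by rewrite addrK.
apply/eqP; rewrite eq_le; apply/andP; split.
  rewrite /rpos rjoinP -rsubr_ge0 addrC addKr rneg_ge0 /=.
  by rewrite -(rleD2r _ _ (- x)) add0r addrC addKr rjoin_l.
rewrite addrC -(rleD2r _ _ (- x)) addrK /rneg rjoinP.
by rewrite rsubr_ge0 rpos_ge andbT -[X in X <= _]add0r rleD2r rpos_ge0.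
Qed.

Lemma ge0_rabs x : 0 <= x -> rabs x = x.
Proof.
move=> x0; apply/eqP; rewrite eq_le rjoin_l andbT rjoinP lexx /=.
by apply: (le_trans _ (x0)); rewrite -rsubr_ge0 opprK add0r.
Qed.

End RieszTheory.

Section TruncTheory.
Context (R : realType) (E : truncRieszType R).
Implicit Types (x y a b c d e : E).

Lemma trunc0 : trunc 0 = 0 :> E.
Proof. by apply/eqP; rewrite eq_le trunc_le ?trunc_ge0. Qed.

Lemma trunc_id a : 0 <= a -> trunc (trunc a) = trunc a.
Proof.
move=> a0; have ta := trunc_ge0 _ a0.
apply/eqP; rewrite eq_le trunc_le //=.
by apply: le_trans (trunc_meet _ _ ta a0); rewrite rmeetP lexx.
Qed.

Lemma trunc_fixed_le a e : 0 <= a -> a <= e -> trunc e = e -> trunc a = a.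
Proof.
move=> a0 ae te; apply/eqP; rewrite eq_le trunc_le //=.
apply: le_trans (trunc_meet _ _ a0 (le_trans a0 ae)).
by rewrite te rmeetP lexx.
Qed.

Lemma trunc_fixed_join a b : 0 <= a -> 0 <= b ->
  trunc a = a -> trunc b = b -> trunc (rjoin a b) = rjoin a b.
Proof.
move=> a0 b0 ta tb; have ab0 : 0 <= rjoin a b := le_trans a0 (rjoin_l _ _).
apply/eqP; rewrite eq_le trunc_le //= rjoinP; apply/andP; split.
  by apply: le_trans (trunc_meet _ _ ab0 a0); rewrite ta rmeetP rjoin_l lexx.
by apply: le_trans (trunc_meet _ _ ab0 b0); rewrite tb rmeetP rjoin_r lexx.
Qed.

Lemma le_scale_trunc (m : R) d s e : 0 < m -> 0 <= s -> 0 <= e ->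
  trunc e = e -> d <= s -> d <= m *: e -> d <= m *: trunc (m^-1 *: s).
Proof.
move=> m0 s0 e0 te ds de.
have mi : 0 <= m^-1 by rewrite invr_ge0 ltW.
have {}de : m^-1 *: d <= e.
  by rewrite -[e]scale1r -(mulVf (lt0r_neq0 m0)) -scalerA rscale_le.
rewrite -[d]scale1r -(divff (lt0r_neq0 m0)) -scalerA.
apply: rscale_le; first exact: ltW.
apply: le_trans (trunc_meet _ _ (riesz_scale_ge0 _ _ mi s0) e0).
by rewrite te rmeetP rscale_le.
Qed.

Lemma scale_trunc_le (m : R) (s : E) : 0 < m -> 0 <= s ->
  m *: trunc (m^-1 *: s) <= s.
Proof.
move=> m0 s0; have mi : 0 <= m^-1 by rewrite invr_ge0 ltW.
rewrite -[X in _ <= X]scale1r -(divff (lt0r_neq0 m0)) -scalerA.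
by rewrite rscale_le ?trunc_le ?riesz_scale_ge0 // ltW.
Qed.

End TruncTheory.

(* The Alexandroff unitization; the pair [(x, a)] stands for [x + a].         *)

Definition unitization (R : realType) (E : truncRieszType R) : Type :=
  (E * R^o)%type.

HB.instance Definition _ (R : realType) (E : truncRieszType R) :=
  GRing.Lmodule.copy (unitization E) (E * R^o)%type.

Definition unitization_ge0 (R : realType) (E : truncRieszType R)
    (z : unitization E) : bool :=
  (z.2 == 0) && (0 <= z.1)
  || (0 < z.2) && (z.2^-1 *: rneg z.1 \in trunc_fixed E).

Section Unitization.
Context (R : realType) (E : truncRieszType R).
Local Notation U := (unitization E).
Implicit Types (z w t : U).

Lemma unitization_ge0P z :
  reflect (0 <= z.2 /\ exists e : E,
             [/\ 0 <= e, trunc e = e & 0 <= z.1 + z.2 *: e])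
          (unitization_ge0 z).
Proof.
case: z => x a /=; apply: (iffP orP) => /=.
- case=> /andP[].
    by move=> /eqP-> x0; split=> //; exists 0; rewrite scaler0 addr0 trunc0.
  move=> a0 /eqP fx; split; first exact: ltW.
  have n0 : 0 <= a^-1 *: rneg x.
    by rewrite riesz_scale_ge0 ?rneg_ge0 // invr_ge0 ltW.
  rewrite ge0_rabs // in fx; exists (a^-1 *: rneg x); split=> //.
  rewrite scalerA divff ?lt0r_neq0 // scale1r -{1}(rposBneg x) subrK.
  exact: rpos_ge0.
- case=> a0 [e [e0 te xe]].
  have [a_eq0|a_neq0] := eqVneq a 0.
    by left; rewrite a_eq0 scale0r addr0 in xe *.
  have a_gt0 : 0 < a by rewrite lt_def a_neq0.
  right; rewrite a_gt0 /= inE.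
  have n0 : 0 <= a^-1 *: rneg x.
    by rewrite riesz_scale_ge0 ?rneg_ge0 // invr_ge0.
  rewrite ge0_rabs //; apply/eqP; apply: trunc_fixed_le te => //.
  rewrite -[e]scale1r -(mulVf a_neq0) -scalerA rscale_le ?invr_ge0 //.
  rewrite /rneg rjoinP riesz_scale_ge0 // andbT.
  by rewrite -rsubr_ge0 opprK addrC.
Qed.

Lemma unitization_ge0D z w :
  unitization_ge0 z -> unitization_ge0 w -> unitization_ge0 (z + w).
Proof.
case: z w => [x a] [y b] /unitization_ge0P[/= a0 [e [e0 te xe]]].
move=> /unitization_ge0P[/= b0 [d [d0 td yd]]].
apply/unitization_ge0P; split=> /=; first exact: addr_ge0.
exists (rjoin e d); split; first exact: le_trans e0 (rjoin_l _ _).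
  exact: trunc_fixed_join.
rewrite scalerDl addrACA raddr_ge0 //.
  by apply: le_trans xe (rleD _ _) => //; rewrite rscale_le ?rjoin_l.
by apply: le_trans yd (rleD _ _) => //; rewrite rscale_le ?rjoin_r.
Qed.

Lemma unitization_ge0Z (k : R) z :
  0 <= k -> unitization_ge0 z -> unitization_ge0 (k *: z).
Proof.
case: z => x a k0 /unitization_ge0P[/= a0 [e [e0 te xe]]].
apply/unitization_ge0P; split=> /=; first exact: mulr_ge0.
by exists e; split=> //; rewrite -scalerA -scalerDr riesz_scale_ge0.
Qed.

Definition unitization_le z w : bool := unitization_ge0 (w - z).

Fact unitization_le_refl : reflexive unitization_le.
Proof.
by move=> z; rewrite /unitization_le subrr /unitization_ge0 /= eqxx lexx.
Qed.

Fact unitization_le_trans : transitive unitization_le.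
Proof.
move=> w z t zw wt; rewrite /unitization_le.
by have := unitization_ge0D wt zw; rewrite addrA subrK.
Qed.

Fact unitization_le_anti : antisymmetric unitization_le.
Proof.
move=> [x a] [y b] /andP[]; rewrite /unitization_le.
move=> /unitization_ge0P[/= ab [e [_ _ xe]]].
move=> /unitization_ge0P[/= ba [d [_ _ yd]]].
rewrite subr_ge0 in ab; rewrite subr_ge0 in ba.
have abE : a = b by apply/eqP; rewrite eq_le ab ba.
move: xe yd; rewrite abE subrr !scale0r !addr0 !rsubr_ge0 => xy yx.
by congr pair; apply/eqP; rewrite eq_le xy yx.
Qed.

HB.instance Definition _ := Order.Le_isPOrder.Build ring_display U
  unitization_le_refl unitization_le_anti unitization_le_trans.

Lemma unitization_leE z w : (z <= w) = unitization_ge0 (w - z).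
Proof. by []. Qed.

(* The positive part of [x + a] is [x^+ - |a| trunc (s / |a|) + a^+], where   *)
(* [s] is [x^-] if [a > 0] and [x^+] otherwise.                               *)
Definition unitization_pos z : U :=
  let s := if 0 < z.2 then rneg z.1 else rpos z.1 in
  (rpos z.1 - `|z.2| *: trunc (`|z.2|^-1 *: s), Num.max z.2 0).

Lemma unitization_posP z w :
  (unitization_pos z <= w) = (z <= w) && (0 <= w).
Proof.
case: z => x a.
set s := if 0 < a then rneg x else rpos x.
set c := trunc (`|a|^-1 *: s).
have s0 : 0 <= s by rewrite /s; case: ifP; rewrite ?rneg_ge0 ?rpos_ge0.
have as0 : 0 <= `|a|^-1 *: s by rewrite riesz_scale_ge0 ?invr_ge0.
have c0 : 0 <= c by apply: trunc_ge0.
have tc : trunc c = c by apply: trunc_id.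
have pE : unitization_pos (x, a) = (rpos x - `|a| *: c, Num.max a 0) by [].
have cs : `|a| *: c <= s.
  have [->|a0] := eqVneq a 0; first by rewrite normr0 scale0r.
  by apply: scale_trunc_le => //; rewrite normr_gt0.
have p0 : 0 <= unitization_pos (x, a).
  rewrite pE; apply/unitization_ge0P; rewrite subr0 /=; split.
    by rewrite le_max lexx orbT.
  exists c; split=> //; case: (ltP 0 a) => [a0|a0].
    by rewrite gtr0_norm // subrK rpos_ge0.
  rewrite scale0r addr0 rsubr_ge0; apply: le_trans cs _.
  by rewrite /s ltNge a0.
have pz : ((x, a) : U) <= unitization_pos (x, a).
  rewrite pE; apply/unitization_ge0P => /=; split.
    by rewrite subr_ge0 le_max lexx.
  have -> : rpos x - `|a| *: c - x = rneg x - `|a| *: c.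
    rewrite -[X in _ - _ - X](rposBneg x) opprB addrCA; congr (_ + _).
    by rewrite addrAC subrr add0r.
  exists c; split=> //; case: (ltP 0 a) => [a0|a0].
    rewrite subrr scale0r addr0 rsubr_ge0; apply: le_trans cs _.
    by rewrite /s a0.
  by rewrite ler0_norm // sub0r subrK rneg_ge0.
apply/idP/andP => [pw|[zw w0]].
  by split; [exact: le_trans pw|exact: le_trans pw].
case: w zw w0 {p0 pz} => y b /unitization_ge0P[/=].
rewrite subr_ge0 => ab [e1 [e10 te1 xe1]] /unitization_ge0P[/=].
rewrite !subr0 => b0 [e2 [e20 te2 ye2]].
pose e := rjoin e1 e2.
have e0 : 0 <= e := le_trans e10 (rjoin_l _ _).
have te : trunc e = e by apply: trunc_fixed_join.
have ye : 0 <= y + b *: e.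
  by apply: le_trans ye2 (rleD _ _) => //; rewrite rscale_le ?rjoin_r.
have xe : x <= y + (b - a) *: e.
  rewrite -rsubr_ge0 addrAC; apply: le_trans xe1 (rleD _ _) => //.
  by rewrite rscale_le ?rjoin_l // subr_ge0.
rewrite pE; apply/unitization_ge0P => /=; split.
  by rewrite subr_ge0 ge_max ab.
exists e; split=> //.
have -> : forall p q f : E, y - (p - q) + f = q - (p - (y + f)).
  by move=> p q f; rewrite !opprB addrCA -addrA addrAC.
rewrite rsubr_ge0; have [a0|a_neq0] := eqVneq a 0.
  rewrite a0 normr0 scale0r maxxx subr0 rleBlDr add0r rjoinP ye andbT.
  by rewrite a0 subr0 in xe.
have am : 0 < `|a| by rewrite normr_gt0.
apply: le_scale_trunc (e0) te _ _ => //; rewrite rleBlDr /s.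
- case: (ltP 0 a) => [a0|a0].
    by rewrite addrC -rleBlDr rposBneg.
  by rewrite subr0 -[X in X <= _]addr0 rleD.
- rewrite addrCA -scalerDl rjoinP.
  case: (ltP 0 a) => [a0|a0].
    rewrite gtr0_norm // [a + _]addrC subrK ye andbT.
    apply: le_trans xe (rleD _ _) => //; apply: rscale_le2 => //.
    by rewrite gerBl ltW.
  rewrite ler0_norm // subr0 [- a + _]addrC xe /=.
  apply: le_trans ye (rleD _ _) => //; apply: rscale_le2 => //.
  by rewrite lerDl oppr_ge0.
Qed.

Definition unitization_join z w : U := unitization_pos (z - w) + w.
Definition unitization_meet z w : U := z - unitization_pos (z - w).

Fact unitization_leD2r z w t : z <= w -> z + t <= w + t.
Proof. by rewrite !unitization_leE opprD addrACA subrr addr0. Qed.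

Fact unitization_scale_ge0 (k : R) z : 0 <= k -> 0 <= z -> 0 <= k *: z.
Proof. by rewrite !unitization_leE !subr0; exact: unitization_ge0Z. Qed.

Fact unitization_meetP z w t :
  (z <= unitization_meet w t) = (z <= w) && (z <= t).
Proof.
have -> : (z <= unitization_meet w t) = (unitization_pos (w - t) <= w - z).
  by rewrite !unitization_leE /unitization_meet addrAC.
rewrite unitization_posP !unitization_leE andbC subr0.
by rewrite opprB [w - z + _]addrC addrA subrK.
Qed.

Fact unitization_joinP z w t :
  (unitization_join z w <= t) = (z <= t) && (w <= t).
Proof.
have -> : (unitization_join z w <= t) = (unitization_pos (z - w) <= t - w).
  by rewrite !unitization_leE /unitization_join opprD addrA addrAC.
by rewrite unitization_posP !unitization_leE subr0 opprB addrA subrK.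
Qed.

HB.instance Definition _ := POrderedLmodule_isRiesz.Build R U
  unitization_leD2r unitization_scale_ge0 unitization_meetP unitization_joinP.

Lemma unitization_embed_le (x y : E) : (((x, 0) : U) <= ((y, 0) : U)) = (x <= y).
Proof.
by rewrite unitization_leE /unitization_ge0 /= subrr eqxx ltxx orbF rsubr_ge0.
Qed.

Lemma unitization_meet1 (x : E) : 0 <= x ->
  rmeet ((x, 0) : U) (0, 1) = (trunc x, 0).
Proof.
move=> x0; have px : rpos x = x.
  by apply/eqP; rewrite eq_le rpos_ge rjoinP lexx x0.
rewrite /rmeet /= /unitization_meet /unitization_pos /= subr0 sub0r.
rewrite oppr_gt0 ltr10 normrN1 invr1 !scale1r px.
congr pair => /=; first by rewrite opprB addrC subrK.
by rewrite max_r ?oppr_le0 ?ler01 ?subr0.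
Qed.

End Unitization.

(* Main.v *)
Require Import Defs.
From mathcomp Require Import all_boot all_order all_algebra.
From mathcomp Require Import classical_sets reals.

(** If [u] is the truncation unit, the fixed points in [E^+] are the elements
    of [[0, u]], so [x + a >= 0] in the unitization if and only if
    [x + a u >= 0] in [E] and [a >= 0]. Hence [x + a |-> (x + a u, a)] is an
    order isomorphism onto the product [E * R], whose factors are both
    uniformly complete. *)

Set Implicit Arguments.
Unset Strict Implicit.
Unset Printing Implicit Defensive.

Import Order.TTheory GRing.Theory Num.Theory.
Local Open Scope ring_scope.
Local Open Scope classical_set_scope.

(** Completeness of the second factor, with [c] standing for [v.2]. Since [v.2] may be zero, the
    bounds keep the form [eps * c]. *)
Lemma real_uniformly_complete (R : realType) (c : R) (a : nat -> R) :
  (forall eps, 0 < eps -> exists N : nat, forall n m, (N <= n)%N ->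
    (N <= m)%N -> `|a n - a m| <= eps * c) ->
  exists r : R, forall eps, 0 < eps -> exists N : nat, forall n, (N <= n)%N ->
    `|a n - r| <= eps * c.
Proof.
(* The limit is [liminf a]. *)
move=> ac; pose L := [set t | exists N, forall n, (N <= n)%N -> t <= a n].
exists (sup L) => eps eps0; have [N aN] := ac eps eps0.
exists N => n Nn.
have an m : (n <= m)%N -> `|a m - a n| <= eps * c.
  by move=> nm; apply: aN => //; apply: leq_trans nm.
(* The set [L] consists of the eventual lower bounds of [a]: it contains [a n - eps * c], and none
   of its members exceeds [a n + eps * c]. So the Cauchy index [N] also serves for the limit. *)
have Ln : L (a n - eps * c).
  by exists n => m /an; rewrite ler_distl => /andP[].
have ubL : ubound L (a n + eps * c).
  move=> t [M tM]; apply: le_trans (tM _ (leq_maxl M n)) _.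
  by have := an _ (leq_maxr M n); rewrite ler_distl => /andP[].
rewrite distrC ler_distl ge_sup ?andbT //; last by exists (a n - eps * c).
by apply: ub_le_sup => //; exists (a n + eps * c).
Qed.

Section UnitalUnitization.
Context (R : realType) (E : truncRieszType R) (u : E).
Hypotheses (u0 : 0 <= u) (truncE : forall x : E, 0 <= x -> trunc x = rmeet x u).
Local Notation U := (unitization E).

(** The linear extension of the identity of [E] that sends [1] to [u]. *)
Definition unital_proj (z : U) : E := z.1 + z.2 *: u.

Lemma unital_projB z w : unital_proj (z - w) = unital_proj z - unital_proj w.
Proof. by rewrite /unital_proj /= scalerBl opprD addrACA. Qed.

Lemma unital_projZ (k : R) z : unital_proj (k *: z) = k *: unital_proj z.
Proof. by rewrite /unital_proj /= scalerDr scalerA. Qed.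

Lemma trunc_unit : trunc u = u.
Proof.
apply/eqP; rewrite eq_le trunc_le //= truncE //.
by rewrite rmeetP lexx.
Qed.

Lemma trunc_le_unit (x : E) : 0 <= x -> trunc x <= u.
Proof.
move=> x0; rewrite truncE //.
by have := lexx (rmeet x u); rewrite rmeetP => /andP[].
Qed.

(** A positive fixed point [e] satisfies [e <= u], so replacing it by [u] can only increase
    [z.1 + z.2 *: e]; conversely [u] is itself a fixed point. *)
Lemma unital_ge0E (z : U) : (0 <= z) = (0 <= unital_proj z) && (0 <= z.2).
Proof.
rewrite unitization_leE subr0; apply/unitization_ge0P/andP.
  move=> [z0 [e [e0 te ze]]]; split=> //; apply: le_trans ze (rleD _ _) => //.
  by rewrite rscale_le // -te trunc_le_unit.
by move=> [pz z0]; split=> //; exists u; split=> //; exact: trunc_unit.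
Qed.

Lemma unital_leE (z w : U) :
  (z <= w) = (unital_proj z <= unital_proj w) && (z.2 <= w.2).
Proof. by rewrite -rsubr_ge0 unital_ge0E unital_projB rsubr_ge0 subr_ge0. Qed.

(** A bound on [rabs z] amounts to the same bound on [z] and [- z], so the coordinatewise order
    suffices and [rabs z] is never computed. *)
Lemma unital_rabs_leE (z w : U) :
  (rabs z <= w) = (rabs (unital_proj z) <= unital_proj w) && (`|z.2| <= w.2).
Proof.
rewrite /rabs !rjoinP !unital_leE -[in - z]sub0r unital_projB.
have -> : unital_proj 0 = 0 by rewrite /unital_proj /= scale0r addr0.
by rewrite !sub0r /= ler_norml lerNl andbACA [X in _ && X]andbC.
Qed.

End UnitalUnitization.

Theorem proposition4p2 (R : realType) (E : truncRieszType R) :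
  unital E -> uniformly_complete E -> uniformly_complete (unitization E).
Proof.
move=> [u [u0 truncE]] complE v v0 x xc.
pose p := @unital_proj R E u.
have leE := unital_rabs_leE u0 truncE.
have pv0 : 0 <= p v.
  by move: v0; rewrite (unital_ge0E u0 truncE) => /andP[].
have [l xl] : exists l, uniform_limit (p v) (p \o x) l.
  apply: complE => // eps /xc[N xN]; exists N => n m Nn Nm.
  have := xN n m Nn Nm.
  by rewrite leE unital_projB unital_projZ => /andP[].
have [r xr] : exists r : R, forall eps, 0 < eps ->
    exists N : nat, forall n, (N <= n)%N -> `|(x n).2 - r| <= eps * v.2.
  apply: real_uniformly_complete => eps /xc[N xN]; exists N => n m Nn Nm.
  by have := xN n m Nn Nm; rewrite leE => /andP[].
(* This is the preimage of [(l, r)] under the isomorphism. *)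
exists ((l - r *: u, r) : unitization E) => eps eps0.
have [N1 xN1] := xl eps eps0; have [N2 xN2] := xr eps eps0.
exists (maxn N1 N2) => n; rewrite geq_max => /andP[/xN1 l1 /xN2 r2].
rewrite leE unital_projB unital_projZ [X in _ - X]subrK.
by apply/andP; split; [exact: l1|exact: r2].
Qed.
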